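(* Each Ann-category is a categorical ring. That is, if $(\mathcal A,\oplus,\otimes,a^+,c,(0,g,d),a,(1,l,r),\mathcal L,\mathcal R)$ is an Ann-category, then $\mathcal A$ with the same addition, multiplication, unit object and constraints (the multiplicative associativity of the categorical ring being $a^{-1}$, the unit laws $l,r$, and the distributive laws $\mathcal L,\mathcal R$) is a categorical ring.
   Context: A symmetric categorical group (also called Pic-category) is a groupoid with a symmetric monoidal structure $(\oplus,a^+,c,(0,g,d))$, where $a^+_{X,Y,Z}:X\oplus(Y\oplus Z)\to(X\oplus Y)\oplus Z$, $c_{X,Y}:X\oplus Y\to Y\oplus X$, $g_X:0\oplus X\to X$, $d_X:X\oplus 0\to X$, in which every object is invertible up to isomorphism for $\oplus$ (it is not required that $c_{X,X}=\mathrm{id}$). In it, $v_{U,V,Z,T}:(U\oplus V)\oplus(Z\oplus T)\to(U\oplus Z)\oplus(V\oplus T)$ denotes the canonical natural isomorphism built from $a^+$, $c$ and identities which exchanges $V$ and $Z$. We write $AB$ for $A\otimes B$. Common data. Both notions below consist of a symmetric categorical group $(\mathcal A,\oplus,a^+,c,(0,g,d))$, a bifunctor $\otimes:\mathcal A\times\mathcal A\to\mathcal A$, an object $1$, natural isomorphisms $a_{A,B,C}:A(BC)\to(AB)C$ (for a categorical ring the associativity law is given in the direction $(AB)C\to A(BC)$; $a$ then denotes its inverse), $l_X:1X\to X$, $r_X:X1\to X$ such that $(\mathcal A,\otimes,a,(1,l,r))$ is a monoidal category, and natural isomorphisms $\mathcal L_{A,X,Y}:A(X\oplus Y)\to AX\oplus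 AY$, $\mathcal R_{X,Y,A}:(X\oplus Y)A\to XA\oplus YA$. Common axioms. For all objects: (1.1) $\mathcal L_{AB,X,Y}\circ a_{A,B,X\oplus Y}=(a_{A,B,X}\oplus a_{A,B,Y})\circ\mathcal L_{A,BX,BY}\circ(\mathrm{id}_A\otimes\mathcal L_{B,X,Y})$; (1.1') $\mathcal R_{XB,YB,A}\circ(\mathcal R_{X,Y,B}\otimes\mathrm{id}_A)\circ a_{X\oplus Y,B,A}=(a_{X,B,A}\oplus a_{Y,B,A})\circ\mathcal R_{X,Y,BA}$; (1.2) $\mathcal R_{AX,AY,B}\circ(\mathcal L_{A,X,Y}\otimes\mathrm{id}_B)\circ a_{A,X\oplus Y,B}=(a_{A,X,B}\oplus a_{A,Y,B})\circ\mathcal L_{A,XB,YB}\circ(\mathrm{id}_A\otimes\mathcal R_{X,Y,B})$; (1.3) $v_{AX,BX,AY,BY}\circ(\mathcal R_{A,B,X}\oplus\mathcal R_{A,B,Y})\circ\mathcal L_{A\oplus B,X,Y}=(\mathcal L_{A,X,Y}\oplus\mathcal L_{B,X,Y})\circ\mathcal R_{A,B,X\oplus Y}$; (1.4) $(l_X\oplus l_Y)\circ\mathcal L_{1,X,Y}=l_{X\oplus Y}$; (1.4') $(r_X\oplus r_Y)\circ\mathcal R_{X,Y,1}=r_{X\oplus Y}$. An Ann-category is such data satisfying the common axioms and (Ann-1): for all objects, $$a^+_{AX,AY,AZ}\circ(\mathrm{id}\oplus\mathcal L_{A,Y,Z})\circ\mathcal L_{A,X,Y\oplus Z}=(\mathcal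 L_{A,X,Y}\oplus\mathrm{id})\circ\mathcal L_{A,X\oplus Y,Z}\circ(\mathrm{id}_A\otimes a^+_{X,Y,Z}),$$ $$c_{AX,AY}\circ\mathcal L_{A,X,Y}=\mathcal L_{A,Y,X}\circ(\mathrm{id}_A\otimes c_{X,Y}),$$ $$a^+_{XA,YA,ZA}\circ(\mathrm{id}\oplus\mathcal R_{Y,Z,A})\circ\mathcal R_{X,Y\oplus Z,A}=(\mathcal R_{X,Y,A}\oplus\mathrm{id})\circ\mathcal R_{X\oplus Y,Z,A}\circ(a^+_{X,Y,Z}\otimes\mathrm{id}_A),$$ $$c_{XA,YA}\circ\mathcal R_{X,Y,A}=\mathcal R_{Y,X,A}\circ(c_{X,Y}\otimes\mathrm{id}_A).$$ A categorical ring is such data satisfying the common axioms and, for all objects $R,X,Y,Z,T,S$: (3.1) $v_{RX,RY,RZ,RT}\circ(\mathcal L_{R,X,Y}\oplus\mathcal L_{R,Z,T})\circ\mathcal L_{R,X\oplus Y,Z\oplus T}=(\mathcal L_{R,X,Z}\oplus\mathcal L_{R,Y,T})\circ\mathcal L_{R,X\oplus Z,Y\oplus T}\circ(\mathrm{id}_R\otimes v_{X,Y,Z,T})$; (3.1') $v_{XS,YS,ZS,TS}\circ(\mathcal R_{X,Y,S}\oplus\mathcal R_{Z,T,S})\circ\mathcal R_{X\oplus Y,Z\oplus T,S}=(\mathcal R_{X,Z,S}\oplus\mathcal R_{Y,T,S})\circ\mathcal R_{X\oplus Z,Y\oplus T,S}\circ(v_{X,Y,Z,T}\otimes\mathrm{id}_S)$.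 *)

(* Defs.v *)
Set Implicit Arguments.
Unset Strict Implicit.
Unset Printing Implicit Defensive.

Declare Scope cat_scope.
Delimit Scope cat_scope with cat.
Local Open Scope cat_scope.

Reserved Notation "X ⊗ Y" (at level 40, left associativity).
Reserved Notation "f ⊠ g" (at level 40, left associativity).
Reserved Notation "X ⊕ Y" (at level 50, left associativity).
Reserved Notation "f ⊞ g" (at level 50, left associativity).
Reserved Notation "g ∘ f" (at level 60, right associativity).

Record category : Type := Category {
  obj :> Type;
  hom : obj -> obj -> Type;
  idm : forall X, hom X X;
  comp : forall X Y Z, hom Y Z -> hom X Y -> hom X Z;
  comp1m : forall X Y (f : hom X Y), comp (idm Y) f = f;
  compm1 : forall X Y (f : hom X Y), comp f (idm X) = f;
  compA : forall X Y Z W (h : hom Z W) (g : hom Y Z) (f : hom X Y),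
    comp h (comp g f) = comp (comp h g) f
}.

Arguments hom {_} _ _.
Arguments idm {_} X.
Arguments comp {_ _ _ _} _ _.

Notation "g ∘ f" := (comp g f) : cat_scope.

Record iso (C : category) (X Y : C) : Type := Iso {
  fwd :> hom X Y;
  bwd : hom Y X;
  bwd_fwd : bwd ∘ fwd = idm X;
  fwd_bwd : fwd ∘ bwd = idm Y
}.

Definition iso_inv (C : category) (X Y : C) (i : iso X Y) : iso Y X :=
  {| fwd := bwd i; bwd := fwd i; bwd_fwd := fwd_bwd i; fwd_bwd := bwd_fwd i |}.

Definition is_groupoid (C : category) : Prop :=
  forall (X Y : C) (f : hom X Y),
    exists g : hom Y X, g ∘ f = idm X /\ f ∘ g = idm Y.

Record bifunctor (C : category) : Type := Bifunctor {
  bobj :> C -> C -> C;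
  bmap : forall X X' Y Y', hom X X' -> hom Y Y' -> hom (bobj X Y) (bobj X' Y');
  bmap_id : forall X Y, bmap (idm X) (idm Y) = idm (bobj X Y);
  bmap_comp : forall X X' X'' Y Y' Y''
      (f' : hom X' X'') (f : hom X X') (g' : hom Y' Y'') (g : hom Y Y'),
    bmap (f' ∘ f) (g' ∘ g) = bmap f' g' ∘ bmap f g
}.

Arguments bmap {_} _ {_ _ _ _} _ _.

(* The associativity constraint goes from the right-bracketed to the
   left-bracketed product. *)
Record is_monoidal (C : category) (T : bifunctor C) (I : C)
    (a : forall X Y Z, iso (T X (T Y Z)) (T (T X Y) Z))
    (l : forall X, iso (T I X) X) (r : forall X, iso (T X I) X) : Prop :=
  IsMonoidal {
  assoc_natural : forall X X' Y Y' Z Z'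
      (f : hom X X') (g : hom Y Y') (h : hom Z Z'),
    a X' Y' Z' ∘ bmap T f (bmap T g h) = bmap T (bmap T f g) h ∘ a X Y Z;
  unitl_natural : forall X X' (f : hom X X'),
    l X' ∘ bmap T (idm I) f = f ∘ l X;
  unitr_natural : forall X X' (f : hom X X'),
    r X' ∘ bmap T f (idm I) = f ∘ r X;
  pentagon : forall X Y Z W,
    a (T X Y) Z W ∘ a X Y (T Z W)
    = bmap T (a X Y Z) (idm W) ∘ a X (T Y Z) W ∘ bmap T (idm X) (a Y Z W);
  triangle : forall X Y,
    bmap T (r X) (idm Y) ∘ a X I Y = bmap T (idm X) (l Y)
}.

Record is_symmetric (C : category) (T : bifunctor C)
    (a : forall X Y Z, iso (T X (T Y Z)) (T (T X Y) Z))
    (c : forall X Y, iso (T X Y) (T Y X)) : Prop := IsSymmetric {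
  comm_natural : forall X X' Y Y' (f : hom X X') (g : hom Y Y'),
    c X' Y' ∘ bmap T f g = bmap T g f ∘ c X Y;
  comm_invol : forall X Y, c Y X ∘ c X Y = idm (T X Y);
  hexagon : forall X Y Z,
    a Z X Y ∘ c (T X Y) Z ∘ a X Y Z
    = bmap T (c X Z) (idm Y) ∘ a X Z Y ∘ bmap T (idm X) (c Y Z)
}.

Record pic_category : Type := PicCategory {
  pic_cat :> category;
  add : bifunctor pic_cat;
  zero : pic_cat;
  addA : forall X Y Z, iso (add X (add Y Z)) (add (add X Y) Z);
  addC : forall X Y, iso (add X Y) (add Y X);
  add0l : forall X, iso (add zero X) X;
  add0r : forall X, iso (add X zero) X;
  pic_groupoid : is_groupoid pic_cat;
  pic_monoidal : is_monoidal addA add0l add0r;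
  pic_symmetric : is_symmetric addA addC;
  pic_invertible : forall X, exists Y,
    inhabited (iso (add X Y) zero) /\ inhabited (iso (add Y X) zero)
}.

Arguments add {_}.
Arguments zero {_}.
Arguments addA {_} X Y Z.
Arguments addC {_} X Y.
Arguments add0l {_} X.
Arguments add0r {_} X.

Notation "X ⊕ Y" := (add X Y) : cat_scope.
Notation "f ⊞ g" := (bmap add f g) : cat_scope.

Definition addACA (P : pic_category) (U V Z T : P) :
    hom ((U ⊕ V) ⊕ (Z ⊕ T)) ((U ⊕ Z) ⊕ (V ⊕ T)) :=
  addA U Z (V ⊕ T)
  ∘ (idm U ⊞ bwd (addA Z V T))
  ∘ (idm U ⊞ (addC V Z ⊞ idm T))
  ∘ (idm U ⊞ addA V Z T)
  ∘ bwd (addA U V (Z ⊕ T)).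

(* The associativity constraint of the multiplication is kept apart from the
   rest of the data because its direction depends on the notion considered. *)
Record distr_data : Type := DistrData {
  dd_pic :> pic_category;
  mul : bifunctor dd_pic;
  one : dd_pic;
  mul1l : forall X, iso (mul one X) X;
  mul1r : forall X, iso (mul X one) X;
  distL : forall A X Y, iso (mul A (X ⊕ Y)) (mul A X ⊕ mul A Y);
  distR : forall X Y A, iso (mul (X ⊕ Y) A) (mul X A ⊕ mul Y A)
}.

Arguments mul {_}.
Arguments one {_}.
Arguments mul1l {_} X.
Arguments mul1r {_} X.
Arguments distL {_} A X Y.
Arguments distR {_} X Y A.

Notation "X ⊗ Y" := (mul X Y) : cat_scope.
Notation "f ⊠ g" := (bmap mul f g) : cat_scope.

Record common_axioms (D : distr_data)
    (a : forall A B C : D, iso (A ⊗ (B ⊗ C)) ((A ⊗ B) ⊗ C)) : Prop :=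
  CommonAxioms {
  mul_monoidal : is_monoidal a mul1l mul1r;
  distL_natural : forall (A A' X X' Y Y' : D)
      (f : hom A A') (g : hom X X') (h : hom Y Y'),
    distL A' X' Y' ∘ (f ⊠ (g ⊞ h)) = ((f ⊠ g) ⊞ (f ⊠ h)) ∘ distL A X Y;
  distR_natural : forall (X X' Y Y' A A' : D)
      (g : hom X X') (h : hom Y Y') (f : hom A A'),
    distR X' Y' A' ∘ ((g ⊞ h) ⊠ f) = ((g ⊠ f) ⊞ (h ⊠ f)) ∘ distR X Y A;
  distL_mulA : forall A B X Y : D,
    distL (A ⊗ B) X Y ∘ a A B (X ⊕ Y)
    = (a A B X ⊞ a A B Y) ∘ distL A (B ⊗ X) (B ⊗ Y) ∘ (idm A ⊠ distL B X Y);
  distR_mulA : forall X Y B A : D,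
    distR (X ⊗ B) (Y ⊗ B) A ∘ (distR X Y B ⊠ idm A) ∘ a (X ⊕ Y) B A
    = (a X B A ⊞ a Y B A) ∘ distR X Y (B ⊗ A);
  distLR_mulA : forall A X Y B : D,
    distR (A ⊗ X) (A ⊗ Y) B ∘ (distL A X Y ⊠ idm B) ∘ a A (X ⊕ Y) B
    = (a A X B ⊞ a A Y B) ∘ distL A (X ⊗ B) (Y ⊗ B) ∘ (idm A ⊠ distR X Y B);
  distLR_addACA : forall A B X Y : D,
    addACA (A ⊗ X) (B ⊗ X) (A ⊗ Y) (B ⊗ Y)
      ∘ (distR A B X ⊞ distR A B Y) ∘ distL (A ⊕ B) X Y
    = (distL A X Y ⊞ distL B X Y) ∘ distR A B (X ⊕ Y);
  distL_one : forall X Y : D,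
    (mul1l X ⊞ mul1l Y) ∘ distL one X Y = mul1l (X ⊕ Y);
  distR_one : forall X Y : D,
    (mul1r X ⊞ mul1r Y) ∘ distR X Y one = mul1r (X ⊕ Y)
}.

Record is_ann_category (D : distr_data)
    (a : forall A B C : D, iso (A ⊗ (B ⊗ C)) ((A ⊗ B) ⊗ C)) : Prop :=
  IsAnnCategory {
  ann_common : common_axioms a;
  distL_addA : forall A X Y Z : D,
    addA (A ⊗ X) (A ⊗ Y) (A ⊗ Z)
      ∘ (idm (A ⊗ X) ⊞ distL A Y Z) ∘ distL A X (Y ⊕ Z)
    = (distL A X Y ⊞ idm (A ⊗ Z)) ∘ distL A (X ⊕ Y) Z ∘ (idm A ⊠ addA X Y Z);
  distL_addC : forall A X Y : D,
    addC (A ⊗ X) (A ⊗ Y) ∘ distL A X Y = distL A Y X ∘ (idm A ⊠ addC X Y);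
  distR_addA : forall X Y Z A : D,
    addA (X ⊗ A) (Y ⊗ A) (Z ⊗ A)
      ∘ (idm (X ⊗ A) ⊞ distR Y Z A) ∘ distR X (Y ⊕ Z) A
    = (distR X Y A ⊞ idm (Z ⊗ A)) ∘ distR (X ⊕ Y) Z A ∘ (addA X Y Z ⊠ idm A);
  distR_addC : forall X Y A : D,
    addC (X ⊗ A) (Y ⊗ A) ∘ distR X Y A = distR Y X A ∘ (addC X Y ⊠ idm A)
}.

(* Here the associativity law [alpha] removes the left bracketing, and the
   common axioms are imposed on its inverse. *)
Record is_categorical_ring (D : distr_data)
    (alpha : forall A B C : D, iso ((A ⊗ B) ⊗ C) (A ⊗ (B ⊗ C))) : Prop :=
  IsCategoricalRing {
  catring_common : common_axioms (fun A B C => iso_inv (alpha A B C));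
  distL_addACA : forall R X Y Z T : D,
    addACA (R ⊗ X) (R ⊗ Y) (R ⊗ Z) (R ⊗ T)
      ∘ (distL R X Y ⊞ distL R Z T) ∘ distL R (X ⊕ Y) (Z ⊕ T)
    = (distL R X Z ⊞ distL R Y T) ∘ distL R (X ⊕ Z) (Y ⊕ T)
      ∘ (idm R ⊠ addACA X Y Z T);
  distR_addACA : forall X Y Z T S : D,
    addACA (X ⊗ S) (Y ⊗ S) (Z ⊗ S) (T ⊗ S)
      ∘ (distR X Y S ⊞ distR Z T S) ∘ distR (X ⊕ Y) (Z ⊕ T) S
    = (distR X Z S ⊞ distR Y T S) ∘ distR (X ⊕ Z) (Y ⊕ T) S
      ∘ (addACA X Y Z T ⊠ idm S)
}.

(* Main.v *)
Require Import Defs.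

Set Implicit Arguments.
Unset Strict Implicit.
Unset Printing Implicit Defensive.

Local Open Scope cat_scope.

(** The interchange [addACA] is a composite of instances of [addA], [addC],
    their inverses and identities, and an Ann-category is one in which the
    endofunctors [A ⊗ -] and [- ⊗ A], with [distL] and [distR] as structure
    morphisms, are compatible with [addA] and [addC].  So they are compatible
    with [addACA], which is what a categorical ring asks for.

    To avoid chasing whiskered diagrams, consider for such a functor [F] the
    comma category of arrows [p : F X -> X'].  It has a sum, [split_sum], which
    first distributes [F] over [⊕] and then adds the two arrows.  The morphisms
    of this category, the squares [intertwines], are closed under composition,
    sums and inverses, and they include the associativity and commutativity
    constraints ([intertwines_addA], [intertwines_addC]).  Hence they include
    the interchange ([intertwines_addACA]); taking all arrows [p] to be
    identities gives the equation looked for.  The common axioms are about the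
    same multiplicative associativity for both notions, since it is inverted
    twice. *)

(** These are the symmetric oplax semigroupal endofunctors of [(P, ⊕)];
    [split_add] has the direction of the distributivity laws. *)
Record add_endofunctor (P : pic_category) : Type := AddEndofunctor {
  fobj :> P -> P;
  fmap : forall {X Y}, hom X Y -> hom (fobj X) (fobj Y);
  fmap_id : forall X, fmap (idm X) = idm (fobj X);
  fmap_comp : forall X Y Z (g : hom Y Z) (f : hom X Y),
    fmap (g ∘ f) = fmap g ∘ fmap f;
  split_add : forall X Y, hom (fobj (X ⊕ Y)) (fobj X ⊕ fobj Y);
  split_add_natural : forall X X' Y Y' (f : hom X X') (g : hom Y Y'),
    split_add X' Y' ∘ fmap (f ⊞ g) = (fmap f ⊞ fmap g) ∘ split_add X Y;
  split_add_addA : forall X Y Z,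
    addA (fobj X) (fobj Y) (fobj Z)
      ∘ (idm (fobj X) ⊞ split_add Y Z) ∘ split_add X (Y ⊕ Z)
    = (split_add X Y ⊞ idm (fobj Z)) ∘ split_add (X ⊕ Y) Z
      ∘ fmap (addA X Y Z);
  split_add_addC : forall X Y,
    addC (fobj X) (fobj Y) ∘ split_add X Y = split_add Y X ∘ fmap (addC X Y)
}.

Arguments fmap {P} F {X Y} _ : rename.
Arguments split_add {P} F X Y : rename.

(** The pair [(f, g)] is a morphism from [p] to [q] in the comma category of [F]
    and the identity functor. *)
Definition intertwines (P : pic_category) (F : add_endofunctor P)
    (X Y X' Y' : P) (p : hom (F X) X') (q : hom (F Y) Y')
    (f : hom X Y) (g : hom X' Y') : Prop :=
  q ∘ fmap F f = g ∘ p.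

Definition split_sum (P : pic_category) (F : add_endofunctor P)
    (X Y X' Y' : P) (p : hom (F X) X') (q : hom (F Y) Y') :
    hom (F (X ⊕ Y)) (X' ⊕ Y') :=
  (p ⊞ q) ∘ split_add F X Y.

Arguments intertwines {P} F {X Y X' Y'} p q f g.
Arguments split_sum {P} F {X Y X' Y'} p q.

Lemma split_sum_id (P : pic_category) (F : add_endofunctor P) (X Y : P) :
  split_sum F (idm (F X)) (idm (F Y)) = split_add F X Y.
Proof. unfold split_sum. rewrite bmap_id. apply comp1m. Qed.

Lemma intertwines_id (P : pic_category) (F : add_endofunctor P)
    (X X' : P) (p : hom (F X) X') :
  intertwines F p p (idm X) (idm X').
Proof.
  unfold intertwines. rewrite fmap_id, compm1, comp1m. reflexivity.
Qed.

Lemma intertwines_comp (P : pic_category) (F : add_endofunctor P)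
    (X Y Z X' Y' Z' : P)
    (p : hom (F X) X') (q : hom (F Y) Y') (r : hom (F Z) Z')
    (f : hom X Y) (f' : hom X' Y') (g : hom Y Z) (g' : hom Y' Z') :
  intertwines F q r g g' -> intertwines F p q f f' ->
  intertwines F p r (g ∘ f) (g' ∘ f').
Proof.
  unfold intertwines. intros Hg Hf.
  rewrite fmap_comp, compA, Hg, <- compA, Hf. apply compA.
Qed.

Lemma intertwines_inv (P : pic_category) (F : add_endofunctor P)
    (X Y X' Y' : P) (p : hom (F X) X') (q : hom (F Y) Y')
    (i : iso X Y) (i' : iso X' Y') :
  intertwines F p q i i' -> intertwines F q p (bwd i) (bwd i').
Proof.
  unfold intertwines. intros H.
  rewrite <- (comp1m (p ∘ _)), <- (bwd_fwd i'), <- compA.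
  rewrite (compA (fwd i') p), <- H, <- compA, <- fmap_comp.
  rewrite fwd_bwd, fmap_id, compm1. reflexivity.
Qed.

Lemma intertwines_add (P : pic_category) (F : add_endofunctor P)
    (X Y Z T X' Y' Z' T' : P)
    (p : hom (F X) X') (q : hom (F Y) Y') (r : hom (F Z) Z') (s : hom (F T) T')
    (f : hom X Y) (f' : hom X' Y') (g : hom Z T) (g' : hom Z' T') :
  intertwines F p q f f' -> intertwines F r s g g' ->
  intertwines F (split_sum F p r) (split_sum F q s) (f ⊞ g) (f' ⊞ g').
Proof.
  unfold intertwines, split_sum. intros Hf Hg.
  rewrite <- compA, split_add_natural, !compA, <- !bmap_comp, Hf, Hg.
  reflexivity.
Qed.

(** Reduces to [split_add_addA], because [p], [q] and [r] can be pulled out of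
    both bracketings by functoriality and moved across [addA] by naturality. *)
Lemma intertwines_addA (P : pic_category) (F : add_endofunctor P)
    (X Y Z X' Y' Z' : P)
    (p : hom (F X) X') (q : hom (F Y) Y') (r : hom (F Z) Z') :
  intertwines F (split_sum F p (split_sum F q r))
    (split_sum F (split_sum F p q) r) (addA X Y Z) (addA X' Y' Z').
Proof.
  unfold intertwines, split_sum.
  assert (HL : ((p ⊞ q) ∘ split_add F X Y) ⊞ r
               = ((p ⊞ q) ⊞ r) ∘ (split_add F X Y ⊞ idm (F Z))).
  { rewrite <- bmap_comp, compm1. reflexivity. }
  assert (HR : p ⊞ ((q ⊞ r) ∘ split_add F Y Z)
               = (p ⊞ (q ⊞ r)) ∘ (idm (F X) ⊞ split_add F Y Z)).
  { rewrite <- bmap_comp, compm1. reflexivity. }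
  rewrite HL, HR, <- !compA, <- split_add_addA, !compA.
  rewrite (assoc_natural (pic_monoidal P)). reflexivity.
Qed.

Lemma intertwines_addC (P : pic_category) (F : add_endofunctor P)
    (X Y X' Y' : P) (p : hom (F X) X') (q : hom (F Y) Y') :
  intertwines F (split_sum F p q) (split_sum F q p) (addC X Y) (addC X' Y').
Proof.
  unfold intertwines, split_sum.
  rewrite <- compA, <- split_add_addC, !compA.
  rewrite (comm_natural (pic_symmetric P)). reflexivity.
Qed.

Lemma intertwines_addACA (P : pic_category) (F : add_endofunctor P)
    (U V Z T U' V' Z' T' : P)
    (p : hom (F U) U') (q : hom (F V) V')
    (r : hom (F Z) Z') (s : hom (F T) T') :
  intertwines F (split_sum F (split_sum F p q) (split_sum F r s))
    (split_sum F (split_sum F p r) (split_sum F q s))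
    (addACA U V Z T) (addACA U' V' Z' T').
Proof.
  unfold addACA.
  (* The intermediate arrows lie over the successive bracketings of the four
     summands, from the target of the interchange back to its source. *)
  apply intertwines_comp
    with (q := split_sum F p (split_sum F r (split_sum F q s))).
  { apply intertwines_addA. }
  apply intertwines_comp
    with (q := split_sum F p (split_sum F (split_sum F r q) s)).
  { apply intertwines_add; [apply intertwines_id|].
    apply intertwines_inv, intertwines_addA. }
  apply intertwines_comp
    with (q := split_sum F p (split_sum F (split_sum F q r) s)).
  { apply intertwines_add; [apply intertwines_id|].
    apply intertwines_add; [apply intertwines_addC|apply intertwines_id]. }
  apply intertwines_comp
    with (q := split_sum F p (split_sum F q (split_sum F r s))).
  { apply intertwines_add; [apply intertwines_id|apply intertwines_addA]. }
  apply intertwines_inv, intertwines_addA.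
Qed.

Lemma split_add_addACA (P : pic_category) (F : add_endofunctor P)
    (X Y Z T : P) :
  addACA (F X) (F Y) (F Z) (F T)
    ∘ (split_add F X Y ⊞ split_add F Z T) ∘ split_add F (X ⊕ Y) (Z ⊕ T)
  = (split_add F X Z ⊞ split_add F Y T) ∘ split_add F (X ⊕ Z) (Y ⊕ T)
    ∘ fmap F (addACA X Y Z T).
Proof.
  pose proof (@intertwines_addACA P F X Y Z T _ _ _ _
                (idm _) (idm _) (idm _) (idm _)) as H.
  unfold intertwines in H. rewrite !split_sum_id in H.
  unfold split_sum in H. rewrite <- compA in H. symmetry. exact H.
Qed.

Definition mull_functor (D : distr_data)
    (a : forall A B C : D, iso (A ⊗ (B ⊗ C)) ((A ⊗ B) ⊗ C))
    (H : is_ann_category a) (A : D) : add_endofunctor D.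
Proof.
  refine (@AddEndofunctor D (fun X => A ⊗ X) (fun X Y f => idm A ⊠ f)
            _ _ (fun X Y => distL A X Y) _ _ _).
  - intros X. apply bmap_id.
  - intros X Y Z g f. rewrite <- bmap_comp, comp1m. reflexivity.
  - intros. apply (distL_natural (ann_common H)).
  - intros. apply (distL_addA H).
  - intros. apply (distL_addC H).
Defined.

Definition mulr_functor (D : distr_data)
    (a : forall A B C : D, iso (A ⊗ (B ⊗ C)) ((A ⊗ B) ⊗ C))
    (H : is_ann_category a) (A : D) : add_endofunctor D.
Proof.
  refine (@AddEndofunctor D (fun X => X ⊗ A) (fun X Y f => f ⊠ idm A)
            _ _ (fun X Y => distR X Y A) _ _ _).
  - intros X. apply bmap_id.
  - intros X Y Z g f. rewrite <- bmap_comp, comp1m. reflexivity.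
  - intros. apply (distR_natural (ann_common H)).
  - intros. apply (distR_addA H).
  - intros. apply (distR_addC H).
Defined.

(** [iso_inv] is an involution only up to eta for [iso], so the axioms are
    transferred one by one; each mentions the forward arrow of [a] alone, and
    this is left unchanged by computation. *)
Lemma common_axioms_iso_invK (D : distr_data)
    (a : forall A B C : D, iso (A ⊗ (B ⊗ C)) ((A ⊗ B) ⊗ C)) :
  common_axioms a ->
  common_axioms (fun A B C : D => iso_inv (iso_inv (a A B C))).
Proof.
  intros [[] ? ? ? ? ? ? ? ?].
  constructor; [constructor; assumption|assumption..].
Qed.

Theorem theorem3 (D : distr_data)
    (a : forall A B C : D, iso (A ⊗ (B ⊗ C)) ((A ⊗ B) ⊗ C)) :
  is_ann_category a ->
  is_categorical_ring (fun A B C : D => iso_inv (a A B C)).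
Proof.
  intros H. constructor.
  - apply common_axioms_iso_invK, (ann_common H).
  - intros R. exact (split_add_addACA (mull_functor H R)).
  - intros X Y Z T S. exact (split_add_addACA (mulr_functor H S) X Y Z T).
Qed.
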